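(* Let $s_n$ be the number of labeled split graphs on $n$ vertices and let $u_n$ be the number of labeled unbalanced split graphs on $n$ vertices. Then almost all labeled split graphs are balanced: $$\lim_{n\to\infty}\frac{u_n}{s_n}=0.$$
   Context: Graphs are finite and simple. A split graph is a graph whose vertices can be partitioned into two (possibly empty) sets $K$ and $S$ such that $K$ is a clique and $S$ is a stable (independent) set; such an ordered partition $(K,S)$ is called a $KS$-partition. A split graph is balanced if it has a unique $KS$-partition, and unbalanced otherwise. Labeled graphs on $n$ vertices are graphs with vertex set $\{1,\dots,n\}$. *)

(* Defs.v *)
From mathcomp Require Import all_boot all_order all_algebra.
From mathcomp Require Import all_classical all_reals all_analysis.

Set Implicit Arguments.
Unset Strict Implicit.
Unset Printing Implicit Defensive.

Section SplitGraphs.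
Variable T : finType.

(* A graph on the vertex set T is given by its set E of edges. *)
Definition simple_graph (E : {set {set T}}) : bool :=
  [forall e in E, #|e| == 2].

Definition clique (E : {set {set T}}) (K : {set T}) : bool :=
  [forall x in K, forall y in K, (x != y) ==> ([set x; y]%SET \in E)].

Definition stable (E : {set {set T}}) (S : {set T}) : bool :=
  [forall x in S, forall y in S, [set x; y]%SET \notin E].

(* The pair is ordered, and either part may be empty. *)
Definition ks_partition (E : {set {set T}}) (KS : {set T} * {set T}) : bool :=
  [&& [disjoint KS.1 & KS.2], KS.1 :|: KS.2 == [set: T]%SET,
      clique E KS.1 & stable E KS.2].

Definition split_graph (E : {set {set T}}) : bool :=
  simple_graph E && [exists KS, ks_partition E KS].

Definition balanced (E : {set {set T}}) : bool :=
  split_graph E && (#|[set KS | ks_partition E KS]%SET| == 1).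

Definition unbalanced (E : {set {set T}}) : bool :=
  split_graph E && ~~ balanced E.

End SplitGraphs.

(* The n labels are 0, ..., n - 1 rather than 1, ..., n. *)
Definition num_split (n : nat) : nat :=
  #|[set E : {set {set 'I_n}} | split_graph E]%SET|.

Definition num_unbalanced (n : nat) : nat :=
  #|[set E : {set {set 'I_n}} | unbalanced E]%SET|.

(* Main.v *)
(* A set K is the clique side of exactly 2^(k(n-k)) labeled split graphs, where
   k = |K|, because only the pairs between K and its complement are free; and a
   split graph has at most (n+1)^2 partitions, since two clique sides differ by
   at most one vertex in each direction. Summing over K therefore counts s_n up
   to a factor (n+1)^2. An unbalanced graph has a partition with clique side K
   and a vertex v of K that can be moved to the stable side; then v has no
   neighbour outside K, so given (K, v) there are at most 2^((k-1)(n-k)) such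
   graphs. The latter is smaller by a factor 2^(n/2) than the number of split
   graphs at K or at K - v, so u_n / s_n is at most 2n(n+1)^2 / 2^(n/2). *)
Require Import Defs.
From mathcomp Require Import all_boot all_order all_algebra.
From mathcomp Require Import all_classical all_reals all_analysis.
(* Re-imported because classical_sets shadows many of their names. *)
From mathcomp Require Import fintype finset.
From mathcomp Require Import zify ring.
Import Order.TTheory GRing.Theory Num.Theory numFieldNormedType.Exports.

Set Implicit Arguments.
Unset Strict Implicit.
Unset Printing Implicit Defensive.

(** * Split graphs with a prescribed clique side *)

Section SplitAt.
Local Open Scope set_scope.
Variable T : finType.
Implicit Types (E : {set {set T}}) (K : {set T}) (A : {set T * T}) (x y v : T).

(** The stable side is always the complement of the clique side, so a partition is recorded by its
    clique side [K] alone. *)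
Definition split_at K : {set {set {set T}}} :=
  [set E | simple_graph E && ks_partition E (K, ~: K)].

Lemma simple_graphP E x y : simple_graph E -> [set x; y] \in E -> x != y.
Proof.
move=> /forall_inP sE /sE; apply: contraTneq => ->.
by rewrite setUid cards1.
Qed.

Lemma split_atP E K : reflect
  [/\ simple_graph E,
      forall x y, x \in K -> y \in K -> x != y -> [set x; y] \in E
    & forall x y, x \notin K -> y \notin K -> [set x; y] \notin E]
  (E \in split_at K).
Proof.
rewrite inE /ks_partition /= -setI_eq0 setICr eqxx setUCr eqxx /=.
apply: (iffP and3P) => -[sE cE iE]; split=> //.
- move=> x y xK yK; apply/implyP; move: y yK; apply/forall_inP.
  by move: x xK; apply/forall_inP.
- move=> x y xK yK; have xC : x \in ~: K by rewrite inE.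
  have yC : y \in ~: K by rewrite inE.
  by move/forall_inP: iE => /(_ x xC) /forall_inP /(_ y yC).
- apply/forall_inP=> x xK; apply/forall_inP=> y yK; apply/implyP; exact: cE.
- apply/forall_inP=> x; rewrite inE => xK; apply/forall_inP=> y.
  rewrite inE => yK; exact: iE.
Qed.

Lemma ks_partition_setC E (KS : {set T} * {set T}) :
  ks_partition E KS -> KS.2 = ~: KS.1.
Proof.
case/and4P=> dKS /eqP uKS _ _; apply/setP=> x; rewrite inE.
have := in_setT x; rewrite -uKS inE.
by have [/(disjointFr dKS)|_ /= ->] := boolP (x \in KS.1).
Qed.

Lemma split_graphP E : reflect (exists K, E \in split_at K) (split_graph E).
Proof.
apply: (iffP andP) => [[sE /existsP[[K S] kE]]|[K]].
  by exists K; rewrite inE sE -(ks_partition_setC kE).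
by rewrite inE => /andP[-> kE]; split=> //; apply/existsP; exists (K, ~: K).
Qed.

(** * Encoding by the edges between the two sides *)

Definition cross E K : {set T * T} :=
  [set p in setX K (~: K) | [set p.1; p.2] \in E].

(** Pairs inside [K] are always edges and pairs outside [K] never are, so two such graphs can differ
    only across. *)
Lemma cross_inj K : {in split_at K &, injective (cross^~ K)}.
Proof.
suff sub E E' : E \in split_at K -> E' \in split_at K ->
    cross E K = cross E' K -> E \subset E'.
  move=> E E' hE hE' eqc; apply/eqP; rewrite eqEsubset.
  by rewrite !sub.
move=> /split_atP[sE _ iE] /split_atP[_ cE' _] eqc; apply/subsetP=> e eE.
have /cards2P[x [y [xy def_e]]] : #|e| == 2 by move/forall_inP: sE => ->.
move: eE; rewrite {e}def_e => eE.
have mix a b : a \in K -> b \notin K -> [set a; b] \in E -> [set a; b] \in E'.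
  move=> aK bK abE; have : (a, b) \in cross E K by rewrite !inE aK bK.
  by rewrite eqc !inE => /andP[].
have [xK|xK] := boolP (x \in K); have [yK|yK] := boolP (y \in K).
- exact: cE'.
- exact: mix.
- by rewrite setUC mix // setUC.
- by move: eE; rewrite (negPf (iE x y xK yK)).
Qed.

(** The complete graph on [K] plus the edges listed in [A]; the size condition cuts the subsets of
    [K] down to pairs. *)
Definition graph_of_cross K (A : {set T * T}) : {set {set T}} :=
  [set e : {set T} | (#|e| == 2) &&
    ((e \subset K) || [exists p in A, e == [set p.1; p.2]])].

Lemma set2_inj x y a b : [set x; y] = [set a; b] ->
  (x = a /\ y = b) \/ (x = b /\ y = a).
Proof.
move=> eq2.
have /set2P hx : x \in [set a; b] by rewrite -eq2 set21.
have /set2P hy : y \in [set a; b] by rewrite -eq2 set22.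
have /set2P ha : a \in [set x; y] by rewrite eq2 set21.
have /set2P hb : b \in [set x; y] by rewrite eq2 set22.
by case: hx hy ha hb => -> [] -> [] ? [] ?; subst; auto.
Qed.

Lemma graph_of_cross_split K A :
  A \subset setX K (~: K) -> graph_of_cross K A \in split_at K.
Proof.
move=> /subsetP sA; apply/split_atP; split.
- by apply/forall_inP=> e; rewrite inE => /andP[].
- by move=> x y xK yK xy; rewrite inE cards2 xy subUset !sub1set xK yK.
- move=> x y xK yK; rewrite inE subUset !sub1set (negPf xK) /= negb_and.
  apply/orP; right; apply/negP => /exists_inP[[a b] /sA].
  rewrite !inE /= => /andP[aK bK] /eqP /set2_inj[] [? ?]; subst.
    by rewrite aK in xK.
  by rewrite aK in yK.
Qed.

Lemma graph_of_crossK K A :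
  A \subset setX K (~: K) -> cross (graph_of_cross K A) K = A.
Proof.
move=> /subsetP sA; apply/setP=> -[x y]; rewrite !inE /= cards2 subUset !sub1set.
apply/idP/idP => [/andP[/andP[xK yK]]|xyA].
  rewrite (negPf yK) andbF /= => /andP[_] /exists_inP[[a b] abA] /=.
  move/eqP/set2_inj => [] [? ?]; subst=> //.
  by move/sA: abA; rewrite !inE (negPf yK).
have := sA _ xyA; rewrite !inE /= => /andP[xK yK]; rewrite xK yK /=.
have -> : x != y by apply: contraNneq yK => <-.
by apply/orP; right; apply/exists_inP; exists (x, y).
Qed.

Lemma card_split_at_ge K : 2 ^ (#|K| * #|~: K|) <= #|split_at K|.
Proof.
rewrite -cardsX -card_powerset.
rewrite -(card_in_imset (f := graph_of_cross K)); last first.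
  move=> A B; rewrite !powersetE => sA sB eqAB.
  by rewrite -(graph_of_crossK sA) eqAB graph_of_crossK.
apply/subset_leq_card/subsetP=> _ /imsetP[A + ->].
rewrite powersetE; exact: graph_of_cross_split.
Qed.

(** Since [v] is on the stable side of the second partition, it has no neighbour outside [K], and
    every cross edge starts in [K :\ v]. *)
Lemma card_split_at_swing K v : v \in K ->
  #|split_at K :&: split_at (K :\ v)| <= 2 ^ (#|K :\ v| * #|~: K|).
Proof.
move=> vK; rewrite -cardsX -card_powerset.
rewrite -(card_in_imset (f := cross^~ K)); last first.
  by move=> E E' /setIP[hE _] /setIP[hE' _]; apply: cross_inj.
apply/subset_leq_card/subsetP=> _ /imsetP[E /setIP[_ /split_atP[_ _ iE]] ->].
rewrite powersetE; apply/subsetP=> -[x y]; rewrite !inE /=.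
move=> /andP[/andP[-> yK] xyE]; rewrite yK !andbT.
apply: contraTneq xyE => ->; apply: iE; first by rewrite !inE eqxx.
by rewrite !inE (negPf yK) andbF.
Qed.

(** * Comparing two partitions of one graph *)

Lemma split_at_swap E K K' x y : E \in split_at K -> E \in split_at K' ->
  x \in K :\: K' -> y \in K :\: K' -> x = y.
Proof.
move=> /split_atP[_ cE _] /split_atP[_ _ iE]; rewrite !inE.
move=> /andP[xK' xK] /andP[yK' yK]; apply/eqP; apply: contraT => xy.
(* Distinct [x] and [y] would be adjacent inside [K] and non-adjacent outside [K']. *)
by have := iE _ _ xK' yK'; rewrite cE.
Qed.

(** Take [v] in [K] but not in [K']. A neighbour [s] of [v] outside [K] lies in [K'], hence is
    adjacent to all of [K], because [v] is the only vertex of [K] missing from [K']; so [s |: K] is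
    a clique side from which [s] can move. Without such an [s], [v] itself can move. *)
Lemma split_at_swing E K K' : E \in split_at K -> E \in split_at K' ->
  ~~ (K \subset K') ->
  exists (L : {set T}) v, v \in L /\ E \in split_at L :&: split_at (L :\ v).
Proof.
move=> hK hK' /subsetPn[v vK vK'].
case/split_atP: (hK) => sE cE iE; case/split_atP: (hK') => _ cE' iE'.
have [/existsP[s /andP[sK vsE]]|/existsPn nadj] :=
    boolP [exists s, (s \notin K) && ([set v; s] \in E)].
  have sK' : s \in K' by apply: contraTT vsE => sK'; apply: iE'.
  exists (s |: K), s; rewrite setU11 setU1K // inE hK andbT; split=> //.
  have adj x : x \in K -> [set s; x] \in E.
    move=> xK; have [xK'|xK'] := boolP (x \in K').
      by apply: cE' => //; apply: contraNneq sK => ->.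
    have -> : x = v by apply: (split_at_swap hK hK'); rewrite inE ?vK' ?xK'.
    by rewrite setUC.
  apply/split_atP; split=> //.
    move=> x y /setU1P[->|xK] /setU1P[->|yK] xy.
    - by rewrite eqxx in xy.
    - exact: adj.
    - by rewrite setUC adj.
    - exact: cE.
  by move=> x y; rewrite !inE !negb_or => /andP[_ xK] /andP[_ yK]; apply: iE.
exists K, v; split=> //; rewrite inE hK; apply/split_atP; split=> //.
  by move=> x y /setD1P[_ xK] /setD1P[_ yK]; apply: cE.
have nadjv y : y \notin K -> [set v; y] \notin E.
  by move=> yK; have := nadj y; rewrite yK.
move=> x y; rewrite !inE !negb_and !negbK.
move=> /orP[/eqP->|xK] /orP[/eqP->|yK].
- by apply/negP => /(simple_graphP sE); rewrite eqxx.
- exact: nadjv.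
- by rewrite setUC nadjv.
- exact: iE.
Qed.

Lemma unbalanced_swing E : unbalanced E ->
  exists (L : {set T}) v, v \in L /\ E \in split_at L :&: split_at (L :\ v).
Proof.
case/andP=> spE; rewrite /balanced spE /= => ne1.
case/andP: (spE) => sE /existsP[KS0 kE0].
have : 1 < #|[set KS | ks_partition E KS]|.
  by rewrite ltn_neqAle eq_sym ne1; apply/card_gt0P; exists KS0; rewrite inE.
case/card_gt1P=> -[K S] [[K' S'] []]; rewrite !inE => kE kE' neq.
move: (ks_partition_setC kE) (ks_partition_setC kE') => /= eS eS'; subst.
have hK : E \in split_at K by rewrite inE sE.
have hK' : E \in split_at K' by rewrite inE sE.
(* Distinct clique sides cannot contain each other both ways, and [K] and [K'] play symmetric
   roles. *)
have [sub|] := boolP (K \subset K'); last exact: split_at_swing hK hK'.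
apply: split_at_swing hK' hK _; apply: contra neq => sub'.
by have -> : K = K' by apply/eqP; rewrite eqEsubset sub.
Qed.

(** Any clique side arises from a fixed [K0] by dropping at most one vertex and adding at most one;
    [None] encodes the choice of no vertex. *)
Lemma card_split_at_multiplicity E :
  #|[set K | E \in split_at K]| <= #|T|.+1 ^ 2.
Proof.
have [->|/set0Pn[K0]] := eqVneq [set K | E \in split_at K] set0.
  by rewrite cards0.
rewrite inE => hK0.
pose seto (o : option T) := if o is Some x then [set x] else set0.
pose f (o : option T * option T) := (K0 :\: seto o.1) :|: seto o.2.
have setoP (B : {set T}) : {in B &, forall x y, x = y} -> exists o, B = seto o.
  move=> h; have [->|/set0Pn[x xB]] := eqVneq B set0; first by exists None.
  exists (Some x); apply/eqP; rewrite eqEsubset sub1set xB andbT.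
  by apply/subsetP=> y yB; rewrite inE (h y x).
have -> : #|T|.+1 ^ 2 = #|[set: option T * option T]|.
  by rewrite cardsT card_prod !card_option.
apply: leq_trans (leq_imset_card f _).
apply/subset_leq_card/subsetP=> K; rewrite inE => hK.
have [x y|o1 e1] := setoP (K0 :\: K); first exact: split_at_swap hK0 hK.
have [x y|o2 e2] := setoP (K :\: K0); first exact: split_at_swap hK hK0.
apply/imsetP; exists (o1, o2) => //; rewrite /f /= -e1 -e2.
by apply/setP=> x; rewrite !inE; case: (x \in K); case: (x \in K0).
Qed.

(** * Double counting over clique sides *)

Lemma sum_card_split_at :
  \sum_(K : {set T}) #|split_at K|
    <= #|[set E : {set {set T}} | split_graph E]| * #|T|.+1 ^ 2.
Proof.
under eq_bigr do rewrite -sum1_card.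
rewrite (exchange_big_dep (mem [set E | split_graph E])) /=; last first.
  by move=> K E _ hE; rewrite inE; apply/split_graphP; exists K.
rewrite -sum_nat_const; apply: leq_sum => E _.
rewrite sum1dep_card; exact: card_split_at_multiplicity.
Qed.

Lemma card_unbalanced_le :
  #|[set E : {set {set T}} | unbalanced E]| <=
  \sum_(v : T) \sum_(K : {set T} | v \in K) 2 ^ (#|K :\ v| * #|~: K|).
Proof.
apply: (@leq_trans
  (\sum_(v : T) \sum_(K : {set T} | v \in K) #|split_at K :&: split_at (K :\ v)|)).
  under eq_bigr do under eq_bigr do rewrite -sum1_card.
  rewrite pair_big_dep /= pair_big_dep /=.
  rewrite sum1dep_card.
  (* The double sum counts triples of [v], [K] and [E]; their projection to [E] covers all
     unbalanced graphs. *)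
  pose g (p : (T * {set T}) * {set {set T}}) := p.2.
  apply: leq_trans (leq_imset_card g _).
  apply/subset_leq_card/subsetP=> E; rewrite inE => /unbalanced_swing[K [v [vK hE]]].
  by apply/imsetP; exists (v, K, E) => //; rewrite inE /= vK.
apply: leq_sum => v _; apply: leq_sum => K; exact: card_split_at_swing.
Qed.

(* As l + (n - l.+1) = n - 1, one of the two summands exceeds
   2 ^ (l * (n - l.+1)) by a factor of at least 2 ^ n./2. *)
Lemma swing_exponent_le l n : l < n ->
  2 ^ n./2 * 2 ^ (l * (n - l.+1))
    <= 2 ^ (l.+1 * (n - l.+1)) + 2 ^ (l * (n - l)).
Proof.
move=> ln; rewrite -expnD.
have [h|h] := leqP n./2 (n - l.+1).
  by apply: leq_trans (leq_addr _ _); rewrite leq_exp2l // mulSn leq_add2r.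
apply: leq_trans (leq_addl _ _); rewrite leq_exp2l //.
rewrite -(subnSK ln) mulnS leq_add2r; lia.
Qed.

Lemma card_unbalanced_split :
  2 ^ #|T|./2 * #|[set E : {set {set T}} | unbalanced E]|
    <= 2 * #|T| * #|T|.+1 ^ 2 * #|[set E : {set {set T}} | split_graph E]|.
Proof.
set n := #|T|; set s := #|[set E | split_graph E]|.
apply: (leq_trans (leq_mul (leqnn _) card_unbalanced_le)).
pose g K := #|split_at K|.
(* The factor [n] pays for the choice of [v], the factor 2 for the two clique sides [K] and
   [K :\ v]. *)
have -> : 2 * n * n.+1 ^ 2 * s = \sum_(v : T) (s * n.+1 ^ 2 + s * n.+1 ^ 2).
  rewrite sum_nat_const -/n; ring.
rewrite big_distrr; apply: leq_sum => v _.
apply: (@leq_trans (\sum_(K : {set T} | v \in K) (g K + g (K :\ v)))).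
  rewrite big_distrr; apply: leq_sum => K vK /=.
  have cK := cardsD1 v K; rewrite vK add1n in cK.
  have cC := cardsCs (~: K); rewrite setCK -/n in cC.
  have ltK : #|K :\ v| < n by rewrite -cK max_card.
  have := swing_exponent_le ltK; rewrite -cK -cC => /leq_trans; apply.
  apply: leq_add (card_split_at_ge K) _.
  have -> : n - #|K :\ v| = #|~: (K :\ v)| by rewrite [RHS]cardsCs setCK.
  exact: card_split_at_ge.
have le_sum : \sum_(K : {set T}) g K <= s * n.+1 ^ 2 by exact: sum_card_split_at.
rewrite big_split /=; apply: leq_add; apply: (leq_trans _ le_sum).
  by rewrite [leqRHS](bigID (fun K => v \in K)) leq_addr.
(* Removing [v] is a bijection from the sets containing [v] to those avoiding it, so no term
   [g (K :\ v)] is counted twice. *)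
rewrite [leqRHS](bigID (fun K => v \notin K)) /=.
apply: leq_trans (leq_addr _ _).
rewrite [leqRHS](reindex_onto (fun K => K :\ v) (fun K => v |: K)) /=; last first.
  by move=> K vK; rewrite setU1K.
rewrite [leqRHS](eq_bigl (fun K => v \in K)) // => K.
rewrite !inE eqxx /=; apply/eqP/idP => [<-|/setD1K //]; exact: setU11.
Qed.

End SplitAt.

(** * Numerical estimates and the limit *)

Lemma expn4_le_exp2 m : (m + 6) ^ 4 <= 1296 * 2 ^ m.
Proof.
(* The base case is [6 ^ 4 = 1296]; 6 is the least shift for which [(m + 7) ^ 4 <= 2 * (m + 6) ^ 4]
   holds from [m = 0] on. *)
elim: m => [//|m IHm].
rewrite [in leqRHS]expnS mulnCA; apply: (leq_trans _ (leq_mul (leqnn 2) IHm)).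
rewrite !expnS expn0; nia.
Qed.

(** The exponential gain absorbs one more factor [n.+1], which bounds the ratio by a multiple of the
    harmonic sequence. *)
Lemma num_unbalanced_le n :
  n.+1 * num_unbalanced n <= 2 * 2 ^ 4 * 1296 * num_split n.
Proof.
have := card_unbalanced_split 'I_n; rewrite card_ord.
rewrite -/(num_unbalanced n) -/(num_split n).
set u := num_unbalanced n; set s := num_split n => le_us.
rewrite -(leq_pmul2l (expn_gt0 2 n./2)) mulnCA.
apply: (leq_trans (leq_mul (leqnn _) le_us)).
rewrite mulnA [leqRHS]mulnA; apply: leq_mul => //.
apply: (@leq_trans (2 * n.+1 ^ 4)); first by rewrite !expnS expn0; nia.
(* Passing from [n.+1] to [2 * (n./2 + 6)] fits [expn4_le_exp2] and costs the factor [2 ^ 4]. *)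
apply: (@leq_trans (2 * (2 * (n./2 + 6)) ^ 4)).
  by rewrite leq_mul2l leq_exp2r //=; lia.
rewrite expnMn mulnA [leqRHS]mulnC -[leqRHS]mulnA leq_mul2l; exact: expn4_le_exp2.
Qed.

Local Open Scope classical_set_scope.
Local Open Scope ring_scope.

Theorem theorem3p6 (R : realType) :
  (fun n : nat => (num_unbalanced n)%:R / (num_split n)%:R : R) @ \oo --> (0 : R).
Proof.
pose C : R := (2 * 2 ^ 4 * 1296)%N%:R.
apply: (@squeeze_cvgr _ _ _ _ (cst 0) (fun n => C * n.+1%:R^-1)).
- near=> n; rewrite /= divr_ge0 //=.
  (* With a zero denominator the quotient is 0 by convention, and the bound still holds. *)
  have [->|s0] := posnP (num_split n); first by rewrite invr0 mulr0 mulr_ge0.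
  rewrite ler_pdivrMr ?ltr0n // mulrAC ler_pdivlMr ?ltr0n //.
  by rewrite -!natrM ler_nat mulnC num_unbalanced_le.
- exact: cvg_cst.
- rewrite -[X in _ --> X](mulr0 C); apply: cvgM; first exact: cvg_cst.
  exact: cvg_harmonic.
Unshelve. all: by end_near.
Qed.
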